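(* Let $\pi_0,\pi_1\in\mathcal P_{\mathcal X}$ with $\pi_1\ll\pi_0$, let $T>0$, and let $$G=\bigl\{(1-\eta)\log\mathbb E_{\pi_0}[L_\eta]\,:\,\eta\in[0,1),\ \mathbb E_{\pi_0}[L_\eta]<\infty\bigr\},\qquad L_\eta=\Bigl(\frac{\mathrm d\pi_1}{\mathrm d\pi_0}\Bigr)^{1/(1-\eta)}.$$ If $1/T\in(0,\sup G)$, then there exist $\eta_\star\in(0,1)$ and a probability measure $\pi_\star\ll\pi_0$ satisfying $$\sup_{\pi\ll\pi_0}\mathbb E_{\pi_1}\Bigl[\Bigl(\frac{\mathrm d\pi}{\mathrm d\pi_0}\Bigr)^{\eta_\star}\Bigr]=\mathbb E_{\pi_1}\Bigl[\Bigl(\frac{\mathrm d\pi_\star}{\mathrm d\pi_0}\Bigr)^{\eta_\star}\Bigr]=e^{1/T},$$ and moreover $$\frac{\mathrm d\pi_\star}{\mathrm d\pi_0}=\frac{L_{\eta_\star}}{\mathbb E_{\pi_0}[L_{\eta_\star}]}\qquad\text{and}\qquad\log\Bigl(\sup_{\pi\ll\pi_0}\mathbb E_{\pi_1}\Bigl[\Bigl(\frac{\mathrm d\pi}{\mathrm d\pi_0}\Bigr)^{\eta_\star}\Bigr]\Bigr)=\eta_\star D_{1/(1-\eta_\star)}(\pi_1\|\pi_0)=\frac1T.$$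
   Context: $\mathcal X$ is a standard Borel space and $\mathcal P_{\mathcal X}$ is the set of Borel probability measures on $\mathcal X$. Suprema over $\pi\ll\pi_0$ range over probability measures $\pi\in\mathcal P_{\mathcal X}$ absolutely continuous with respect to $\pi_0$. For $\xi>1$ and $\pi\ll\pi'$, $D_\xi(\pi\|\pi')=\frac{1}{\xi-1}\log\mathbb E_{\pi'}\bigl[(\mathrm d\pi/\mathrm d\pi')^\xi\bigr]$ is the Rényi divergence of order $\xi$. *)

(* Defs.v *)
From HB Require Import structures.
From mathcomp Require Import all_boot all_order all_algebra.
From mathcomp Require Import all_classical all_reals all_analysis.

Set Implicit Arguments.
Unset Strict Implicit.
Unset Printing Implicit Defensive.

Import Order.TTheory GRing.Theory Num.Theory.
Import numFieldNormedType.Exports.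

Local Open Scope classical_set_scope.
Local Open Scope ring_scope.
Local Open Scope charge_scope.

(* Complete (every Cauchy filter converges) and separable. The library's
   completeType is not used because it also demands a distinguished point. *)
Definition polish (R : realType) (M : metricType R) : Prop :=
  (forall F : set_system M, ProperFilter F -> cauchy F ->
     exists l : M, F --> l) /\
  (exists2 D : set M, countable D & dense D).

(* Isomorphic, as a measurable space, to a Polish space with its Borel
   sigma-algebra. *)
Definition standard_borel (R : realType) d (X : measurableType d) : Prop :=
  exists (M : metricType R) (f : X -> M),
    [/\ polish M, bijective f &
        forall A : set X, measurable A <-> <<s @open M >> (f @` A)].

Section divergences.
Context d (X : measurableType d) (R : realType).
Implicit Types (p q r : probability X R) (eta xi : R).

(* dp/dq. The library derivative has values in \bar R, but is finite at every
   point when p `<< q, so that fine loses nothing; it is determined only up to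
   a q-null set, on which it may be negative. *)
Definition density p q (x : X) : R :=
  fine (('d (charge_of_finite_measure p) '/d q) x).

Local Open Scope ereal_scope.

(* Meaningful for 1 < xi and p `<< q; +oo when the expectation is infinite. *)
Definition renyi xi p q : \bar R :=
  ((xi - 1)^-1)%:E * lne 'E_q[fun x => (density p q x `^ xi)%R].

Definition tilt p q eta (x : X) : R := (density p q x `^ (1 - eta)^-1)%R.

(* A subset of \bar R so that its supremum is +oo when it is unbounded. *)
Definition tilt_range p q : set (\bar R) :=
  [set (1 - eta)%:E * lne 'E_q[tilt p q eta] | eta in
    [set eta : R | (0 <= eta < 1)%R /\ 'E_q[tilt p q eta] < +oo]].

Definition sup_moment p q eta : \bar R :=
  ereal_sup [set 'E_p[fun x => (density r q x `^ eta)%R] |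
    r in [set r : probability X R | r `<< q]].

End divergences.

(* Main.v *)
(* Write f for dpi1/dpi0, l = 1 / (1 - eta) and m(l) = E_pi0[f^l]. Dominated
   convergence makes m continuous on [1, b] when m(b) is finite; m(1) = 1, and
   the hypothesis gives such a b with m(b) > exp(b / T), so the intermediate
   value theorem yields l > 1 with m(l) = exp(l / T). With phi = f^l / m(l) one
   has f = exp(1/T) phi^(1 - eta), so for any density g Young's inequality gives
   g^eta f <= exp(1/T) (eta g + (1 - eta) phi), whose integral is exp(1/T),
   with equality at g = phi. *)
Require Import Defs.
From HB Require Import structures.
From mathcomp Require Import all_boot all_order all_algebra.
From mathcomp Require Import all_classical all_reals all_analysis.
From mathcomp Require Import measurable_realfun ring lra.

Set Implicit Arguments.
Unset Strict Implicit.
Unset Printing Implicit Defensive.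

Import Order.TTheory GRing.Theory Num.Theory.
Import numFieldNormedType.Exports.

Local Open Scope classical_set_scope.
Local Open Scope ring_scope.
Local Open Scope ereal_scope.

(** * Probability measures defined by a density *)

Section density_measure.
Context (d : measure_display) (X : measurableType d) (R : realType).
Context (q : probability X R) (f : X -> R)
  (mf : measurable_fun [set: X] f) (f0 : forall x, (0 <= f x)%R)
  (f1 : \int[q]_x (f x)%:E = 1).

(* The three proofs are arguments so that the measure and probability instances
   below can be inferred from the term. *)
Definition density_measure of measurable_fun [set: X] f &
    (forall x, (0 <= f x)%R) & \int[q]_x (f x)%:E = 1 :=
  fun A : set X => \int[q]_(x in A) (f x)%:E.

Local Notation nu := (density_measure mf f0 f1).

Let nu0 : nu set0 = 0. Proof. by rewrite /density_measure integral_set0. Qed.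

Let nu_ge0 A : 0 <= nu A.
Proof. by apply: integral_ge0 => x _; rewrite lee_fin. Qed.

Let nu_sigma_additive : semi_sigma_additive nu.
Proof.
by apply: semi_sigma_additive_nng_induced => //; exact/measurable_EFinP.
Qed.

HB.instance Definition _ :=
  isMeasure.Build _ _ _ nu nu0 nu_ge0 nu_sigma_additive.

Let nuT : nu [set: X] = 1. Proof. exact: f1. Qed.

HB.instance Definition _ := Measure_isProbability.Build _ _ _ nu nuT.

End density_measure.

(** * Expectations, powers and versions of the Radon-Nikodym derivative *)

Section expectation_density.
Context (d : measure_display) (X : measurableType d) (R : realType).
Implicit Types (p q : probability X R) (f g : X -> R).

Lemma measurable_fun_powR f (a : R) : measurable_fun [set: X] f ->
  measurable_fun [set: X] (fun x => (f x `^ a)%R).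
Proof. exact: (@measurableT_comp _ _ _ _ _ _ (@powR R ^~ a)). Qed.

Lemma ae_eq_expectation q f g :
    measurable_fun [set: X] f -> measurable_fun [set: X] g ->
  ae_eq q [set: X] f g -> 'E_q[f] = 'E_q[g].
Proof.
move=> mf mg fg; rewrite unlock; apply: ae_eq_integral => //.
- exact/measurable_EFinP.
- exact/measurable_EFinP.
- exact: (ae_eq_comp EFin fg).
Qed.

Lemma measurable_density p q : p `<< q -> measurable_fun [set: X] (density p q).
Proof.
by move=> pq; apply: (@measurableT_comp _ _ _ _ _ _ fine).
Qed.

(* The library derivative may be negative on a null set, where powR takes the
   junk value 1; the expectations are moved to a nonnegative version. *)
Lemma density_ge0_version p q : p `<< q ->
  exists f, [/\ measurable_fun [set: X] f, forall x, (0 <= f x)%R,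
    ae_eq q [set: X] (density p q) f &
    forall h : X -> R, measurable_fun [set: X] h -> (forall x, (0 <= h x)%R) ->
      'E_p[h] = 'E_q[(h \* f)%R]].
Proof.
move=> pq; pose F := Radon_Nikodym_SigmaFinite.f p q.
have F_fin x : F x \is a fin_num by exact: Radon_Nikodym_SigmaFinite.f_fin_num.
have F0 x : 0 <= F x by exact: Radon_Nikodym_SigmaFinite.f_ge0.
exists (fine \o F); split.
- apply: (@measurableT_comp _ _ _ _ _ _ fine) => //.
  by apply: measurable_int; exact: Radon_Nikodym_SigmaFinite.f_integrable.
- by move=> x; rewrite fine_ge0.
- apply: (ae_eq_comp fine); apply: ae_eq_sym.
  exact: ae_eq_Radon_Nikodym_SigmaFinite.
- move=> h mh h0; rewrite unlock.
  rewrite -(Radon_Nikodym_SigmaFinite.change_of_variables pq) //; last first.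
  exact/measurable_EFinP.
  by apply: eq_integral => x _; rewrite EFinM /= fineK.
Qed.

Section uniqueness.
Context (q : probability X R) (f : X -> R)
  (mf : measurable_fun [set: X] f) (f0 : forall x, (0 <= f x)%R)
  (f1 : \int[q]_x (f x)%:E = 1).

Lemma density_measure_dominates : density_measure mf f0 f1 `<< q.
Proof.
apply/null_content_dominatesP => A mA qA0.
rewrite /= /density_measure; apply: null_set_integral => //.
by apply/measurable_funTS/measurable_EFinP.
Qed.

(** Both functions have the same integral over every measurable set, which determines an integrable
    function almost everywhere. *)
Lemma density_density_measure :
  ae_eq q [set: X] (density (density_measure mf f0 f1) q) f.
Proof.
apply: (@ae_eq_trans _ _ _ _ _ _ _ (fine \o (EFin \o f)));
  last exact: ae_eq_refl.
apply: (ae_eq_comp fine); apply: integral_ae_eq => //.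
- exact/Radon_Nikodym_integrable/density_measure_dominates.
- exact/measurable_EFinP.
- move=> A _ mA; rewrite -Radon_Nikodym_integral//.
  exact: density_measure_dominates.
Qed.

End uniqueness.

(** * Existence of the exponent *)

(** The difference of the two sides is negative at [l = 1], where it is [1 - expR v], and positive
    at [b], so it vanishes in between and not at 1. The case [b = 1] is vacuous. *)
Lemma exists_expectation_powR_eq q f (b v : R) :
    measurable_fun [set: X] f -> (forall x, (0 <= f x)%R) ->
    (0 < v)%R -> (1 <= b)%R -> 'E_q[f] = 1 ->
    (expR (b * v))%:E < 'E_q[fun x => (f x `^ b)%R] < +oo ->
  exists2 l : R, (1 < l)%R & 'E_q[fun x => (f x `^ l)%R] = (expR (l * v))%:E.
Proof.
move=> mf f0 v0 b1 Ef /andP[Eb Eboo].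
have mpow l := measurable_fun_powR l mf.
(* The exponent is clamped to [1, b], so that continuity of the moment holds on
   an open neighbourhood of [1, b], endpoints included. *)
pose cl (l : R) : R := Num.max 1%R (Num.min l b).
have cl_ge1 l : (1 <= cl l)%R by rewrite /cl le_max lexx.
have cl_leb l : (cl l <= b)%R by rewrite /cl ge_max b1 ge_min lexx orbT.
have clE l : (1 <= l <= b)%R -> cl l = l.
  by move=> /andP[l1 lb]; rewrite /cl (min_l lb) (max_r l1).
(* A dominating function independent of [l]: the power increases with the exponent where [f x] is at
   least 1, and is at most 1 elsewhere. *)
have f_le l x : (f x `^ cl l <= 1 + f x `^ b)%R.
  have [fx1|fx1] := leP 1%R (f x).
    by rewrite (le_trans (ler_powR fx1 (cl_leb l)))// lerDr.
  have [->|fx0] := eqVneq (f x) 0%R.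
    by rewrite powR0 ?addr_ge0 ?powR_ge0// gt_eqF// (lt_le_trans ltr01).
  have fxp : (0 < f x)%R by rewrite lt_neqAle eq_sym fx0 f0.
  apply: (@le_trans _ _ 1%R); last by rewrite lerDl powR_ge0.
  rewrite -(powRr0 (f x)); apply: ger_powR; last exact: le_trans (cl_ge1 l).
  by rewrite fxp ltW.
have int_b : q.-integrable [set: X] (EFin \o (fun x => f x `^ b)%R).
  apply/integrableP; split; first exact/measurable_EFinP.
  move: Eboo; rewrite unlock; congr (_ < _); apply: eq_integral => x _ /=.
  by rewrite ger0_norm// powR_ge0.
have int_g : q.-integrable [set: X] (EFin \o (fun x => 1 + f x `^ b)%R).
  have := integrableD measurableT
    (finite_measure_integrable_cst q 1%R measurableT) int_b.
  by apply: eq_integrable.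
have int_cl l : q.-integrable [set: X] (EFin \o (fun x => f x `^ cl l)%R).
  apply: le_integrable int_g => //; first exact/measurable_EFinP.
  move=> x _ /=; rewrite lee_fin !ger0_norm ?powR_ge0//.
  by rewrite addr_ge0// powR_ge0.
have E_cl l : 'E_q[fun x => (f x `^ cl l)%R] =
    (\int[q]_x (f x `^ cl l))%R%:E.
  rewrite unlock /Rintegral fineK//.
  exact: (integrable_fin_num measurableT (int_cl l)).
pose D (l : R) : R := (\int[q]_x (f x `^ cl l) - expR (l * v))%R.
have cD : {in `]0%R, (b + 1)%R[, continuous D}.
  move=> l lb; apply: cvgB; last first.
    apply: continuous_comp; last exact: continuous_expR.
    by apply: cvgM; [exact: cvg_id|exact: cvg_cst].
  apply: (@continuity_under_integral R _ X q (fun l x => (f x `^ cl l)%R)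
    [set: X] measurableT 0%R (b + 1)%R _ _ (fun x => 1 + f x `^ b)%R) => //.
  - apply: aeW => x _ y _.
    have ccl : {for y, continuous cl}.
      apply: (@continuous_max _ _ (cst 1%R)); first exact: cvg_cst.
      by apply: continuous_min; [exact: cvg_id|exact: cvg_cst].
    (* Where [f x] is 0 the power is constantly 0, since the clamped exponent is never 0; elsewhere
       [powR] is an exponential of a continuous function. *)
    have [->|fx0] := eqVneq (f x) 0%R.
      have -> : (fun l => 0 `^ cl l)%R = cst 0%R.
        by apply/funext => l'; rewrite powR0// gt_eqF// (lt_le_trans ltr01).
      exact: cvg_cst.
    rewrite /powR (negbTE fx0).
    apply: continuous_comp; last exact: continuous_expR.
    by apply: cvgM; [exact: ccl|exact: cvg_cst].
  - by move=> y _; apply: aeW => x _; rewrite ger0_norm ?powR_ge0.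
  - by rewrite inE/=.
have within_D : {within `[1%R, b], continuous D}.
  apply: continuous_in_subspaceT => l /set_mem/=.
  rewrite in_itv/= => /andP[l1 lb].
  by apply: cD; rewrite in_itv/=; apply/andP; split; lra.
have D1 : (D 1 < 0)%R.
  rewrite /D subr_lt0 mul1r -lte_fin -E_cl clE ?lexx//.
  rewrite (_ : 'E_q[_] = 'E_q[f]); first by rewrite Ef lte_fin expR_gt1.
  by congr expectation; apply/funext => x; rewrite powRr1.
have Db : (0 < D b)%R.
  by rewrite /D subr_gt0 -lte_fin -E_cl clE ?lexx ?b1.
have [|l] := IVT b1 within_D (v := 0%R).
  by rewrite (min_l (ltW (lt_trans D1 Db))) (max_r (ltW (lt_trans D1 Db))) !ltW.
rewrite in_itv/= => lb Dl; exists l.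
  case/andP: lb; rewrite le_eqVlt => /predU1P[l1|//].
  by move: D1; rewrite l1 Dl ltxx.
by move/eqP: Dl; rewrite subr_eq0 => /eqP <-; rewrite -E_cl clE.
Qed.

(** * Young's inequality and the bound on the moment *)

(** Young's inequality for [a ^ t] and [b ^ (1 - t)] with the conjugate exponents [1 / t] and
    [1 / (1 - t)]. *)
Lemma young_powR (a b t : R) : (0 <= a)%R -> (0 <= b)%R -> (0 < t < 1)%R ->
  (a `^ t * b `^ (1 - t) <= t * a + (1 - t) * b)%R.
Proof.
move=> a0 b0 /andP[t0 t1]; have t'0 : (0 < 1 - t)%R by rewrite subr_gt0.
have := conjugate_powR (powR_ge0 a t) (powR_ge0 b (1 - t)) (p := t^-1%R)
  (q := (1 - t)^-1%R).
rewrite !invr_gt0 !invrK -!powRrM !mulfV ?gt_eqF// !powRr1// (addrC t) subrK.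
by rewrite (mulrC t) (mulrC (1 - t)%R); apply.
Qed.

(** Recovers a value of [f] from the tilted density [f ^ l / expR (l * v)]. *)
Lemma tilted_powR_inv (a l v : R) : (0 <= a)%R -> (0 < l)%R ->
  (expR v * (a `^ l / expR (l * v)) `^ l^-1)%R = a.
Proof.
move=> a0 l0; rewrite powRM ?powR_ge0 ?invr_ge0 ?expR_ge0// -powRrM.
rewrite mulfV ?gt_eqF// powRr1// -expRN -expRM mulrCA -expRD.
by rewrite mulNr mulrAC mulfV ?gt_eqF// mul1r addrN expR0 mulr1.
Qed.

Lemma expectation_powR_le q f g (l v : R) :
    measurable_fun [set: X] f -> (forall x, (0 <= f x)%R) ->
    measurable_fun [set: X] g -> (forall x, (0 <= g x)%R) ->
    (1 < l)%R -> 'E_q[fun x => (f x `^ l)%R] = (expR (l * v))%:E ->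
    'E_q[g] = 1 ->
  'E_q[fun x => (g x `^ (1 - l^-1) * f x)%R] <= (expR v)%:E.
Proof.
move=> mf f0 mg g0 l1 El Eg.
have l0 : (0 < l)%R by rewrite (lt_trans ltr01).
have l'01 : (0 < 1 - l^-1 < 1)%R.
  by rewrite subr_gt0 invf_lt1// l1 ltrBlDr ltrDl invr_gt0.
(* The Young weights [1 - l^-1] and [l^-1], scaled by [expR v]; the extra divisor in [c'] normalises
   [f ^ l]. After integration the two terms add up to [expR v]. *)
pose c : R := (expR v * (1 - l^-1))%R.
pose c' : R := (expR v * l^-1 / expR (l * v))%R.
have c0 : (0 <= c)%R by rewrite mulr_ge0 ?expR_ge0//; case/andP: l'01 => /ltW.
have c'0 : (0 <= c')%R by rewrite !mulr_ge0 ?invr_ge0 ?expR_ge0 ?ltW.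
have le_cc' x : (g x `^ (1 - l^-1) * f x <= c * g x + c' * f x `^ l)%R.
  pose u := (f x `^ l / expR (l * v))%R.
  have u0 : (0 <= u)%R by rewrite divr_ge0 ?powR_ge0 ?expR_ge0.
  rewrite -{1}(tilted_powR_inv v (f0 x) l0) -/u mulrCA.
  have -> : (c * g x + c' * f x `^ l =
    expR v * ((1 - l^-1) * g x + l^-1 * u))%R by rewrite /c /c' /u; ring.
  rewrite ler_wpM2l ?expR_ge0//.
  by have := young_powR (g0 x) u0 l'01; rewrite subKr.
have -> : (expR v)%:E = c%:E * 'E_q[g] + c'%:E * 'E_q[fun x => (f x `^ l)%R].
  rewrite Eg El -!EFinM -EFinD /c /c' mulfVK ?gt_eqF ?expR_gt0//.
  by rewrite mulr1 -mulrDr subrK mulr1.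
rewrite unlock -!ge0_integralZl_EFin//; last 4 first.
- by move=> x _; rewrite lee_fin powR_ge0.
- exact/measurable_EFinP/measurable_fun_powR.
- by move=> x _; rewrite lee_fin.
- exact/measurable_EFinP.
rewrite -ge0_integralD//; last 4 first.
- by move=> x _; rewrite -EFinM lee_fin mulr_ge0.
- by apply/measurable_EFinP/measurable_funM.
- by move=> x _; rewrite -EFinM lee_fin mulr_ge0 ?powR_ge0.
- by apply/measurable_EFinP/measurable_funM => //; exact: measurable_fun_powR.
apply: ge0_le_integral => //.
- by move=> x _; rewrite lee_fin mulr_ge0 ?powR_ge0.
- by apply/measurable_EFinP/measurable_funM => //; exact: measurable_fun_powR.
- by apply/measurable_EFinP/measurable_funD; apply: measurable_funM => //;
    exact: measurable_fun_powR.
- by move=> x _; rewrite lee_fin.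
Qed.

(** The equality case: with [u] the tilted density, [f] is [expR v * u ^ l^-1], so the integrand is
    [expR v * u], and [u] has mean 1. *)
Lemma expectation_powR_eq q f (l v : R) :
    measurable_fun [set: X] f -> (forall x, (0 <= f x)%R) ->
    (1 < l)%R -> 'E_q[fun x => (f x `^ l)%R] = (expR (l * v))%:E ->
  'E_q[fun x => ((f x `^ l / expR (l * v)) `^ (1 - l^-1) * f x)%R]
  = (expR v)%:E.
Proof.
move=> mf f0 l1 El; have l0 : (0 < l)%R by rewrite (lt_trans ltr01).
pose c : R := (expR v / expR (l * v))%R.
transitivity (c%:E * 'E_q[fun x => (f x `^ l)%R]); last first.
  by rewrite El -EFinM /c mulfVK ?gt_eqF ?expR_gt0.
rewrite unlock -ge0_integralZl_EFin//; last 3 first.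
- by move=> x _; rewrite lee_fin powR_ge0.
- exact/measurable_EFinP/measurable_fun_powR.
- by rewrite divr_ge0 ?expR_ge0.
apply: eq_integral => x _; rewrite -EFinM; congr EFin.
pose u := (f x `^ l / expR (l * v))%R; rewrite -/u.
have u0 : (0 <= u)%R by rewrite divr_ge0 ?powR_ge0 ?expR_ge0.
(* The exponents add up to 1, which is nonzero, so the power law also covers [u = 0]. *)
rewrite -{1}(tilted_powR_inv v (f0 x) l0) -/u mulrCA -powRD; last first.
  by rewrite subrK oner_eq0.
rewrite subrK powRr1// /u /c.
by rewrite mulrAC -mulrA mulrCA.
Qed.

End expectation_density.

(** * Optimality of the tilted measure and the value of the divergence *)

Theorem proposition4 (R : realType) (d : measure_display)
    (X : measurableType d) (hX : standard_borel R X)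
    (pi0 pi1 : probability X R) (hpi : pi1 `<< pi0)
    (T : R) (hT : (0 < T)%R)
    (hG : 0 < (T^-1)%:E < ereal_sup (tilt_range pi1 pi0)) :
  exists (eta : R) (pis : probability X R),
    [/\ (0 < eta < 1)%R,
        pis `<< pi0,
        sup_moment pi1 pi0 eta = 'E_pi1[fun x => (density pis pi0 x `^ eta)%R]
        /\ 'E_pi1[fun x => (density pis pi0 x `^ eta)%R] = (expR T^-1)%:E,
        {ae pi0, forall x, (density pis pi0 x)%:E =
           (tilt pi1 pi0 eta x)%:E / 'E_pi0[tilt pi1 pi0 eta]} &
        lne (sup_moment pi1 pi0 eta) = eta%:E * renyi (1 - eta)^-1 pi1 pi0
        /\ eta%:E * renyi (1 - eta)^-1 pi1 pi0 = (T^-1)%:E].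
Proof.
have [f [mf f0 fE Ef]] := density_ge0_version hpi.
have tiltE eta :
    'E_pi0[tilt pi1 pi0 eta] = 'E_pi0[fun x => (f x `^ (1 - eta)^-1)%R].
  apply: ae_eq_expectation.
  - exact/measurable_fun_powR/measurable_density.
  - exact: measurable_fun_powR.
  - exact: (ae_eq_comp (@powR R ^~ _) fE).
have Ef1 : 'E_pi0[f] = 1.
  rewrite -(expectation_cst pi1 1) Ef//.
  by congr expectation; apply/funext => x /=; rewrite mul1r.
have v0 : (0 < T^-1)%R by rewrite invr_gt0.
have [l l1 El] : exists2 l : R, (1 < l)%R &
    'E_pi0[fun x => (f x `^ l)%R] = (expR (l * T^-1))%:E.
  case/andP: hG => _ /ereal_sup_gt[_ [t [/andP[t0 t1] Et] <-]].
  have t'0 : (0 < 1 - t)%R by rewrite subr_gt0.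
  rewrite tiltE in Et *; move=> vE.
  (* The point [t] comes from an element of [tilt_range] above [T^-1]; multiplying by [b] and
     exponentiating gives the required lower bound on the moment. *)
  apply: (exists_expectation_powR_eq (b := (1 - t)^-1%R)) => //.
    by rewrite invf_ge1// lerBlDr lerDl.
  apply/andP; split => //.
  (* Nonpositive values have [lne] equal to [-oo], which cannot exceed [T^-1]. *)
  move: Et vE; case: ('E_pi0[_]) => [r| |]//; last first.
    by rewrite /= gt0_muleNy ?lte_fin.
  have [r0 _|r0 _] := ltP 0%R r; last first.
    by rewrite le0_lneNy ?lee_fin// gt0_muleNy ?lte_fin.
  rewrite lne_EFin// -EFinM !lte_fin => vr.
  rewrite -[ltRHS]lnK ?posrE// ltr_expR mulrC ltr_pdivrMr// mulrC.
  exact: vr.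
(* Solves [1 / (1 - eta) = l]. *)
pose eta : R := (1 - l^-1)%R.
have l0 : (0 < l)%R by rewrite (lt_trans ltr01).
have eta01 : (0 < eta < 1)%R.
  by rewrite subr_gt0 invf_lt1// l1 ltrBlDr ltrDl invr_gt0.
have etal : ((1 - eta)^-1 = l)%R by rewrite opprB addrC subrK invrK.
pose phi x : R := (f x `^ l / expR (l * T^-1))%R.
have mphi : measurable_fun [set: X] phi.
  by apply: measurable_funM => //; exact: measurable_fun_powR.
have phi0 x : (0 <= phi x)%R by rewrite divr_ge0 ?powR_ge0 ?expR_ge0.
have phi1 : \int[pi0]_x (phi x)%:E = 1.
  under eq_integral do rewrite EFinM muleC.
  rewrite ge0_integralZl_EFin ?invr_ge0 ?expR_ge0//.
  - by move: El; rewrite unlock => ->; rewrite -EFinM mulVf ?gt_eqF ?expR_gt0.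
  - by move=> x _; rewrite lee_fin powR_ge0.
  - exact/measurable_EFinP/measurable_fun_powR.
pose pis := density_measure mphi phi0 phi1.
have dpis : pis `<< pi0 by exact: density_measure_dominates.
have pisE := density_density_measure mphi phi0 phi1.
have Epis : 'E_pi1[fun x => (density pis pi0 x `^ eta)%R] = (expR T^-1)%:E.
  rewrite Ef; last 2 first.
    exact/measurable_fun_powR/measurable_density.
    by move=> x; exact: powR_ge0.
  rewrite -(expectation_powR_eq mf f0 l1 El); apply: ae_eq_expectation.
  - apply: measurable_funM => //.
    exact/measurable_fun_powR/measurable_density.
  - by apply: measurable_funM => //; exact: measurable_fun_powR.
  - exact: (ae_eq_mul2r f (ae_eq_comp (@powR R ^~ eta) pisE)).
have sup_eq : sup_moment pi1 pi0 eta = (expR T^-1)%:E.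
  apply/eqP; rewrite eq_le; apply/andP; split; last first.
    by rewrite -Epis; apply: ereal_sup_ubound; exists pis.
  (* Each competitor [r] is replaced by a density [g] nonnegative everywhere, to which the Young
     bound applies. *)
  apply: ge_ereal_sup => _ [r rpi0 <-].
  have [g [mg g0 gE Eg]] := density_ge0_version rpi0.
  have Eg1 : 'E_pi0[g] = 1.
    rewrite -(expectation_cst r 1) Eg//.
    by congr expectation; apply/funext => x /=; rewrite mul1r.
  apply: le_trans (expectation_powR_le mf f0 mg g0 l1 El Eg1).
  rewrite Ef; last 2 first.
    exact/measurable_fun_powR/measurable_density.
    by move=> x; exact: powR_ge0.
  rewrite le_eqVlt; apply/orP; left; apply/eqP; apply: ae_eq_expectation.
  - apply: measurable_funM => //.
    exact/measurable_fun_powR/measurable_density.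
  - by apply: measurable_funM => //; exact: measurable_fun_powR.
  - exact: (ae_eq_mul2r f (ae_eq_comp (@powR R ^~ eta) gE)).
have renyiE : eta%:E * renyi (1 - eta)^-1 pi1 pi0 = (T^-1)%:E.
  have Erenyi :
      'E_pi0[fun x => (density pi1 pi0 x `^ l)%R] = (expR (l * T^-1))%:E.
    by rewrite -El -etal -tiltE.
  rewrite /renyi etal Erenyi lne_EFin ?expR_gt0// expRK -!EFinM; congr EFin.
  have l10 : (l - 1 != 0)%R by rewrite subr_eq0 gt_eqF.
  (* Here [eta] is [(l - 1) / l], which cancels the factor [l / (l - 1)] left by the divergence. *)
  rewrite /eta; field.
  by rewrite l10 !gt_eqF.
exists eta, pis; split => //.
- by rewrite sup_eq Epis.
- rewrite tiltE etal El; move: pisE fE.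
  apply: filterS2 => x /(_ I) -> /(_ I) fx.
  by rewrite /tilt etal fx inver gt_eqF ?expR_gt0// -EFinM.
- by rewrite sup_eq renyiE lne_EFin ?expR_gt0// expRK.
Qed.
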